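(* Let $G$ be a finite simple graph with Edmonds–Gallai decomposition $V(G)=\mathcal{A}\sqcup\mathcal{C}\sqcup\mathcal{D}$, and let $G_1,\dots,G_k$ be the connected components of $G[\mathcal{D}]$. If $S$ is a critical independent set of $G$, then $S \subseteq \mathcal{C} \cup \bigcup_{i:\,|V(G_i)|=1} V(G_i)$.
   Context: Edmonds–Gallai decomposition: $\mathcal{D}$ is the set of vertices of $G$ that are not covered by at least one maximum matching of $G$; $\mathcal{A}$ is the set of vertices not in $\mathcal{D}$ adjacent to some vertex of $\mathcal{D}$; $\mathcal{C}=V(G)\setminus(\mathcal{A}\cup\mathcal{D})$. $G[U]$ is the induced subgraph on $U$. For $A\subseteq V(G)$, $N(A)$ is the set of vertices adjacent to some vertex of $A$, $d(A)=|A|-|N(A)|$, $d_c(G)=\max\{d(A):A\subseteq V(G)\}$, and $A$ is critical if $d(A)=d_c(G)$. *)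

(* Defs.v *)
From mathcomp Require Import all_boot all_order all_algebra.

Set Implicit Arguments.
Unset Strict Implicit.
Unset Printing Implicit Defensive.

Import Order.TTheory GRing.Theory Num.Theory.

(* A finite simple graph is given by a vertex type [T : finType] and a
   symmetric irreflexive adjacency relation [e : rel T]; symmetry and
   irreflexivity are hypotheses of the theorems, not of the definitions. *)
Section Graph.
Variables (T : finType) (e : rel T).
Implicit Types (x y : T) (A B S U : {set T}) (M N : {set {set T}}).

Definition edges : {set {set T}} :=
  [set E | [exists x, exists y, e x y && (E == [set x; y])]].

Definition matching M : bool := (M \subset edges) && trivIset M.

Definition maximum_matching M : bool :=
  matching M && [forall N, matching N ==> (#|N| <= #|M|)].

Definition EG_D : {set T} :=
  [set x | [exists M, maximum_matching M && (x \notin cover M)]].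

Definition EG_A : {set T} :=
  [set x | (x \notin EG_D) && [exists y in EG_D, e x y]].

Definition EG_C : {set T} := ~: (EG_A :|: EG_D).

Definition induced U : rel T := [rel x y | [&& x \in U, y \in U & e x y]].

(* The vertex sets of the connected components of the subgraph induced by U. *)
Definition components U : {set {set T}} :=
  equivalence_partition (connect (induced U)) U.

(* This may meet A: a vertex of A with a neighbour in A belongs to it. *)
Definition neighbours A : {set T} := [set y | [exists x in A, e x y]].

(* Integer-valued, since ssrnat subtraction truncates at 0. *)
Definition difference A : int := (#|A|%:Z - #|neighbours A|%:Z)%R.

(* The starting point set0 of the arg max is only a witness that there are
   sets to range over; the maximum is over all A. *)
Definition critical_difference : int :=
  difference [arg max_(A > set0) difference A]%O.

Definition critical A : bool := difference A == critical_difference.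

Definition independent S : bool :=
  [forall x in S, forall y in S, ~~ e x y].

End Graph.

(* Main.v *)
Require Import Defs.
From mathcomp Require Import all_boot all_order all_algebra.
From mathcomp Require Import zify.

(** Criticality of [S] gives Hall's condition for matching [N(S)] into [S]: if
    [B] is a subset of [N(S)], then [S \ N(B)] has its neighbours in
    [N(S) \ B]. Every edge that touches [S] or [N(S)] touches [N(S)], as [S] is
    independent. So in a maximum matching that missed a vertex of [N(S)], the
    edges touching [S] or [N(S)] would be fewer than [N(S)], and replacing them
    by a matching of [N(S)] into [S] would give a larger matching. Hence [N(S)]
    does not meet [D], so no vertex of [S] lies in [A], and a vertex of [S] in
    [D] is isolated in [G[D]]. *)

Set Implicit Arguments.
Unset Strict Implicit.
Unset Printing Implicit Defensive.

(* Rado's argument: if [F y] has two elements, one of them can be deleted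
   without violating Hall's condition, by submodularity of
   [B |-> #|\bigcup_(z in B) F z|]. *)
Theorem Hall_sdr (I T : finType) (t0 : T) (Y : {set I}) (F : I -> {set T}) :
  (forall B : {set I}, B \subset Y -> #|B| <= #|\bigcup_(y in B) F y|) ->
  exists2 f : I -> T, {in Y &, injective f} & {in Y, forall y, f y \in F y}.
Proof.
have [n] := ubnP (\sum_(y in Y) #|F y|); elim: n F => // n IHn F ltn hall.
have [/existsP[y /andP[yY]] | /existsPn F1] := boolP [exists y in Y, 1 < #|F y|].
  case/card_gt1P=> s1 [s2 [s1F s2F s12]].
  (* If removing [s] from [F y] keeps Hall's condition, the induction hypothesis gives the
     representatives. Otherwise a violating set [B] must contain [y], the only index whose set has
     changed, and [C] is [B :\ y]. *)
  have delete s : s \in F y ->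
      (exists2 f : I -> T, {in Y &, injective f} & {in Y, forall z, f z \in F z})
      \/ exists C : {set I}, [/\ C \subset Y, y \notin C &
            #|(F y :\ s) :|: \bigcup_(z in C) F z| <= #|C|].
    move=> sF; pose F' z := if z == y then F z :\ s else F z.
    have F'E (C : {set I}) : y \notin C ->
        \bigcup_(z in C) F' z = \bigcup_(z in C) F z.
      move=> yC; apply: eq_bigr => z zC; rewrite /F'.
      by case: eqP zC yC => // -> ->.
    have F'sub z : F' z \subset F z.
      by rewrite /F'; case: eqP => // _; apply: subsetDl.
    have [/forallP hall' | /forallPn[B]] := boolP
        [forall B : {set I}, (B \subset Y) ==> (#|B| <= #|\bigcup_(z in B) F' z|)].
      left; have [||f finj fF] := IHn F'.
      - rewrite -ltnS; apply: leq_trans ltn; rewrite ltnS (bigD1 y) //=.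
        rewrite [X in _ < X](bigD1 y) //= -addSn leq_add //.
          by rewrite /F' eqxx [X in _ < X](cardsD1 s) sF.
        by apply: leq_sum => z _; apply: subset_leq_card.
      - by move=> B; apply/implyP; apply: hall'.
      by exists f => // z zY; apply: (subsetP (F'sub z)); apply: fF.
    rewrite negb_imply -ltnNge => /andP[BY ltB]; right.
    have yB : y \in B.
      by apply: contraLR ltB => yB; rewrite -leqNgt F'E // hall.
    exists (B :\ y); split; rewrite ?setD11 //.
      exact: subset_trans (subsetDl _ _) BY.
    move: ltB; rewrite (cardsD1 y) yB ltnS (big_setD1 y) //= F'E ?setD11 //.
    by rewrite /F' eqxx.
  have [//|[C1 [C1Y yC1 le1]]] := delete s1 s1F.
  have [//|[C2 [C2Y yC2 le2]]] := delete s2 s2F.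
  set N1 := _ :|: _ in le1; set N2 := _ :|: _ in le2.
  (* As [s1] and [s2] differ, [F y] is the union of [F y :\ s1] and [F y :\ s2], so [N1 :|: N2]
     contains [F z] for every [z] in [y |: (C1 :|: C2)]. The index [y] accounts for the
     successor. *)
  have leU : #|C1 :|: C2|.+1 <= #|N1 :|: N2|.
    have yU : y \notin C1 :|: C2 by rewrite inE negb_or yC1.
    have := hall (y |: (C1 :|: C2)); rewrite cardsU1 yU add1n.
    rewrite subUset sub1set yY subUset C1Y C2Y => /(_ isT)/leq_trans; apply.
    apply: subset_leq_card; apply/bigcupsP => z; rewrite !inE.
    case/or3P=> [/eqP-> | zC | zC]; apply/subsetP=> t tF; rewrite !inE.
    - by rewrite tF !andbT; case: (t =P s1) => //= ->; rewrite s12 orbT.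
    - by apply/orP; left; apply/orP; right; apply/bigcupP; exists z.
    - by apply/orP; right; apply/orP; right; apply/bigcupP; exists z.
  have leI : #|C1 :&: C2| <= #|N1 :&: N2|.
    have := hall (C1 :&: C2) (subset_trans (subsetIl _ _) C1Y).
    move/leq_trans; apply; apply: subset_leq_card; apply/bigcupsP => z.
    rewrite inE => /andP[zC1 zC2]; apply/subsetP=> t tF; rewrite !inE.
    by apply/andP; split; apply/orP; right; apply/bigcupP; exists z.
  (* [#|C1| + #|C2| + 1 <= #|N1 :|: N2| + #|N1 :&: N2| = #|N1| + #|N2| <= #|C1| + #|C2|], a
     contradiction. *)
  have := cardsUI C1 C2; have := cardsUI N1 N2; lia.
(* Now each [F y] with [y] in [Y] is a singleton, and Hall's condition for pairs makes these
   singletons distinct. The default [t0] can only occur outside [Y]. *)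
have F_gt0 y : y \in Y -> exists t, t \in F y.
  move=> yY; have := hall [set y]; rewrite sub1set yY cards1 big_set1.
  by move=> /(_ isT)/card_gt0P.
pose f y := odflt t0 [pick t in F y].
have fF y : y \in Y -> f y \in F y.
  by move=> /F_gt0[t tF]; rewrite /f; case: pickP => [//|/(_ t)]; rewrite tF.
exists f => // y z yY zY fyz; apply/eqP/negPn/negP=> neq_yz.
have F1E u : u \in Y -> F u = [set f u].
  move=> uY; apply/esym/eqP; rewrite eqEcard sub1set fF //= cards1 leqNgt.
  by have := F1 u; rewrite uY.
have := hall [set y; z]; rewrite subUset !sub1set yY zY => /(_ isT).
by rewrite cards2 neq_yz big_setU1 ?inE //= big_set1 !F1E // fyz setUid cards1.
Qed.

Section CriticalIndependent.
Variables (T : finType) (e : rel T).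
Hypothesis e_sym : symmetric e.
Implicit Types (x y s : T) (A B S : {set T}) (M : {set {set T}}).

Lemma critical_max S A : critical e S -> (difference e A <= difference e S)%R.
Proof.
rewrite /critical /critical_difference => /eqP->.
by case: (@Order.TotalTheory.arg_maxP _ _ _ set0 xpredT) => // B _; apply.
Qed.

Lemma mem_neighbours A x y : x \in A -> e x y -> y \in neighbours e A.
Proof. by move=> xA exy; rewrite inE; apply/existsP; exists x; rewrite xA. Qed.

Lemma edgesP (E : {set T}) :
  reflect (exists x y, e x y /\ E = [set x; y]) (E \in edges e).
Proof.
rewrite inE; apply: (iffP existsP) => [[x /existsP[y /andP[exy /eqP->]]]|].
  by exists x, y.
by case=> x [y [exy ->]]; exists x; apply/existsP; exists y; rewrite exy eqxx.
Qed.

Lemma independent_neighbours S : independent e S -> [disjoint S & neighbours e S].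
Proof.
move=> /forallP indS; rewrite -setI_eq0; apply/eqP/setP => y; rewrite !inE.
apply/andP=> -[yS /existsP[x /andP[xS exy]]].
by have /implyP/(_ xS)/forallP/(_ y) := indS x; rewrite yS exy.
Qed.

(** Deleting [NB] from [S] loses [#|NB|] vertices and at least [#|B|] neighbours; since [S] is
    critical, this cannot increase the difference. *)
Lemma critical_Hall S B : critical e S -> B \subset neighbours e S ->
  #|B| <= #|\bigcup_(y in B) [set s in S | e y s]|.
Proof.
move=> Scrit BN; set NB := \bigcup_(y in B) _.
have NBS : NB \subset S by apply/bigcupsP => y _; apply/subsetP=> s /[!inE] /andP[].
have /subset_leq_card : neighbours e (S :\: NB) \subset neighbours e S :\: B.
  apply/subsetP=> y; rewrite inE => /existsP[s /andP[/setDP[sS sNB] esy]].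
  rewrite inE (mem_neighbours sS esy) andbT; apply: contra sNB => yB.
  by apply/bigcupP; exists y => //; rewrite inE sS e_sym.
have := critical_max (S :\: NB) Scrit; rewrite /difference.
have := cardsID NB S; have := cardsID B (neighbours e S).
rewrite (setIidPr BN) (setIidPr NBS); lia.
Qed.

Lemma critical_matching S (t0 : T) : critical e S ->
  exists2 f : T -> T, {in neighbours e S &, injective f}
    & {in neighbours e S, forall y, f y \in S /\ e y (f y)}.
Proof.
move=> Scrit; have [f finj fF] := Hall_sdr t0 (fun B => @critical_Hall S B Scrit).
by exists f => // y /fF /[!inE] /andP.
Qed.

Lemma neighbours_covered S M : critical e S -> independent e S ->
  maximum_matching e M -> neighbours e S \subset cover M.
Proof.
move=> Scrit Sind /andP[/andP[Medges Mtriv] /forallP Mmax].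
apply/subsetP=> x xN; apply/negPn/negP=> xM.
have SN := independent_neighbours Sind.
have [f finj fS] := critical_matching x Scrit.
have memN s y : s \in S -> e s y -> y \in neighbours e S by apply: mem_neighbours.
move: (neighbours e S) => N in xN SN finj fS memN *.
(* The exchange: [M0] keeps the edges of [M] that avoid [N] and [S], and [P] matches all of [N] into
   [S]. *)
pose far (E : {set T}) := [disjoint E & N :|: S]; pose M0 := [set E in M | far E].
pose P := [set [set y; f y] | y in N].
have PNS E : E \in P -> E \subset N :|: S.
  case/imsetP=> y yN ->; have [fyS _] := fS y yN.
  by rewrite subUset !sub1set !inE yN fyS orbT.
have pair_inj : {in N &, injective (fun y => [set y; f y])}.
  move=> y z yN zN /setP/(_ y); rewrite !inE eqxx /= => /esym/orP[/eqP//|/eqP yfz].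
  by have [fzS _] := fS z zN; rewrite yfz (disjointFr SN fzS) in yN.
have touch_N E : E \in M -> ~~ far E -> exists2 y, y \in E & y \in N.
  move=> EM /pred0Pn[u /= /andP[uE]].
  rewrite inE => /orP[|uS]; first by exists u.
  have /edgesP[a [b [eab EE]]] := subsetP Medges _ EM.
  move: uE; rewrite EE !inE => /orP[]/eqP ua; rewrite ua in uS.
    by exists b; [rewrite !inE eqxx orbT | apply: memN uS eab].
  by exists a; [rewrite !inE eqxx | apply: memN uS _; rewrite e_sym].
have lt_touch : #|M :\: M0| < #|N|.
  pose h (E : {set T}) := odflt x [pick y in E :&: N].
  have hP E : E \in M :\: M0 -> h E \in E :&: N.
    rewrite !inE => /andP[/nandP H EM].
    have [|y yE yN] := touch_N E EM; first by case: H => //; rewrite EM.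
    by rewrite /h; case: pickP => [z|/(_ y)]; rewrite !inE ?yE ?yN.
  have hM E : E \in M :\: M0 -> E \in M by case/setDP.
  rewrite -(card_in_imset (f := h)) => [|E1 E2 E1M E2M hE].
    rewrite (cardsD1 x N) xN ltnS; apply: subset_leq_card.
    apply/subsetP=> y /imsetP[E EM ->].
    have /setIP[hE hN] := hP E EM; rewrite !inE hN andbT.
    by apply: contraNneq xM => <-; apply/bigcupP; exists E; rewrite ?hM.
  have /setIP[h1 _] := hP _ E1M; have /setIP[h2 _] := hP _ E2M.
  apply/eqP/negPn/negP=> /(trivIsetP Mtriv _ _ (hM _ E1M) (hM _ E2M)).
  by move/disjointFr/(_ h1); rewrite hE h2.
have M0P : [disjoint M0 & P].
  rewrite -setI_eq0; apply/eqP/setP=> E; rewrite !inE; apply/andP=> -[/andP[_ Efar]].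
  case/imsetP=> y yN EE; have yE : y \in E by rewrite EE !inE eqxx.
  by have := disjointFr Efar yE; rewrite inE yN.
have cardM' : #|M0 :|: P| = #|M0| + #|N|.
  have := cardsUI M0 P; move: M0P; rewrite -setI_eq0 => /eqP->.
  by rewrite cards0 addn0 => ->; rewrite card_in_imset.
have match' : matching e (M0 :|: P).
  apply/andP; split.
    rewrite subUset; apply/andP; split; apply/subsetP=> E.
      by rewrite inE => /andP[/(subsetP Medges)].
    by case/imsetP=> y yN ->; apply/edgesP; exists y, (f y); have [_ ?] := fS y yN.
  apply/trivIsetP=> E1 E2.
  have mix E E' : E \in M0 -> E' \in P -> [disjoint E & E'].
    rewrite inE => /andP[_ Efar] /PNS E'NS.
    by rewrite disjoint_sym; apply: disjointWl E'NS _; rewrite disjoint_sym.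
  case/setUP=> h1 /setUP[] h2.
  - by move: h1 h2 => /[!inE] /andP[h1 _] /andP[h2 _]; apply: (trivIsetP Mtriv).
  - by move=> _; apply: mix.
  - by move=> _; rewrite disjoint_sym; apply: mix.
  (* Two distinct edges of [P] are disjoint: their ends in [N] differ, their ends in [S] differ as
     [f] is injective, and [N] does not meet [S]. *)
  case/imsetP: h1 => y yN ->; case/imsetP: h2 => z zN -> neq.
  have neq_yz : y != z by apply: contraNneq neq => ->.
  have [fyS _] := fS y yN; have [fzS _] := fS z zN.
  have NSF u v : u \in N -> v \in S -> (u == v) = false.
    by move=> uN vS; apply: contraTF uN => /eqP->; rewrite (disjointFr SN vS).
  rewrite -setI_eq0; apply/eqP/setP=> u; rewrite !inE; apply/negP.
  case/andP=> /orP[]/eqP-> /orP[].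
  - by rewrite (negPf neq_yz).
  - by rewrite NSF.
  - by rewrite eq_sym NSF.
  - by move/eqP/finj => /(_ yN zN) yz; rewrite yz eqxx in neq_yz.
(* [#|M0| + #|N|] exceeds [#|M0| + #|M :\: M0| = #|M|], against the maximality of [M]. *)
have /implyP/(_ match') := Mmax (M0 :|: P).
have M0M : M0 \subset M by apply/subsetP=> E /[!inE] /andP[].
have := cardsID M0 M; rewrite (setIidPr M0M) cardM'; lia.
Qed.

Lemma neighbours_notin_EG_D S x : critical e S -> independent e S ->
  x \in neighbours e S -> x \notin EG_D e.
Proof.
move=> Scrit Sind xN; rewrite inE; apply/existsPn=> M; rewrite negb_and negbK.
case: (boolP (maximum_matching e M)) => //= Mmax.
exact: (subsetP (neighbours_covered Scrit Sind Mmax)).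
Qed.

(** A nonempty path from [x] would begin with an edge to a vertex of [U], so the connectivity class
    of [x] is [x] alone. *)
Lemma isolated_component (U : {set T}) x : x \in U ->
  (forall y, y \in U -> ~~ e x y) -> [set x] \in components e U.
Proof.
move=> xU iso; apply/imsetP; exists x => //; apply/setP=> y; rewrite !inE.
apply/eqP/andP=> [-> | [yU /connectP[[|z p] /=]]]; first by rewrite connect0.
  by move=> _ ->.
by case/andP=> /and3P[_ zU exz]; rewrite (negPf (iso z zU)) in exz.
Qed.

End CriticalIndependent.

Theorem theorem5p5 (T : finType) (e : rel T)
    (e_sym : symmetric e) (e_irr : irreflexive e)
    (S : {set T}) (S_crit : critical e S) (S_indep : independent e S) :
  S \subset EG_C e :|: \bigcup_(X in components e (EG_D e) | #|X| == 1) X.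
Proof.
have S_iso s y : s \in S -> y \in EG_D e -> ~~ e s y.
  move=> sS; apply: contraL => esy.
  exact: neighbours_notin_EG_D S_crit S_indep (mem_neighbours sS esy).
apply/subsetP=> s sS; rewrite inE.
have [sD | sD] := boolP (s \in EG_D e).
  apply/orP; right; apply/bigcupP; exists [set s]; rewrite ?set11 // cards1 eqxx.
  by rewrite isolated_component // => y; apply: S_iso.
apply/orP; left; rewrite in_setC in_setU negb_or sD andbT inE sD /=.
apply/existsPn=> y; apply/negP=> /andP[yD].
by apply/negP; apply: S_iso.
Qed.
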